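(* Let $1\le\kappa<6/5$ and put $\gamma(\kappa)=\frac{3}{\kappa}-\frac52$. Assume the $abc$ inequality with exponent $\kappa$ for the set of coprime triples formed by the integers $x^3$, $|k|$, $y^2$, where $(x,y,k)$ ranges over all primitive solutions of $y^2=x^3+k$. Then, for every $\delta\in(0,\gamma(\kappa))$, only finitely many primitive solutions satisfy $|k|<x^{\gamma(\kappa)-\delta}$. For $\kappa=1$, in particular, the $abc$ conjecture implies the weak Hall conjecture for primitive solutions, that is: for every $\delta>0$, there are only finitely many primitive solutions $(x,y,k)$ with $0<|k|<x^{1/2-\delta}$.
   Context: A solution is a triple $(x,y,k)$ of integers with $y^2=x^3+k$, $x\ge 1$, $y\ge 1$ and $k\ne 0$. It is primitive when $\gcd(x,y)=1$. A coprime triple is an (unordered) triple of coprime positive integers one of which is the sum of the other two. Its quality is $\frac{\log m}{\log r}$, where $m$ is its largest term and $r$ is the radical (the product of the distinct prime divisors) of the product of its three terms. For a primitive solution $(x,y,k)$, the integers $x^3$, $|k|$, $y^2$ form a coprime triple, with largest term $\max\{x^3,y^2\}$ and radical $\operatorname{rad}(xy|k|)$. For $\kappa\ge 1$, the $abc$ inequality with exponent $\kappa$ is said to hold for a set of coprime triples when, for every $\varepsilon>0$, only finitely many triples in the set have quality above $\kappa+\varepsilon$. The $abc$ conjecture is the $abc$ inequality with exponent $1$ for the set of all coprime triples. *)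

(* Defs.v *)
From mathcomp Require Import all_boot all_order all_algebra finmap multiset.
From mathcomp Require Import all_classical all_reals all_analysis.

Set Implicit Arguments.
Unset Strict Implicit.
Unset Printing Implicit Defensive.

Import Order.TTheory GRing.Theory Num.Theory.

Local Open Scope classical_set_scope.
Local Open Scope mset_scope.
Local Open Scope ring_scope.

Definition solution (x y k : int) : Prop :=
  [/\ y ^+ 2 = x ^+ 3 + k, 1 <= x, 1 <= y & k != 0].

Definition primitive_solution (x y k : int) : Prop :=
  solution x y k /\ gcdz x y = 1.

(* Unordered triples of positive integers are multisets, so that a triple such
   as {1, 1, 2} keeps its repeated term. *)
Definition triple (a b c : nat) : {mset nat} := seq_mset [:: a; b; c].

Definition coprime_triples : set {mset nat} :=
  [set t | exists a b c : nat,
     [/\ t = triple a b c, [/\ (0 < a)%N, (0 < b)%N & (0 < c)%N],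
         gcdn (gcdn a b) c = 1%N & c = (a + b)%N]].

Definition radical (n : nat) : nat := (\prod_(p <- primes n) p)%N.

Definition quality (R : realType) (t : {mset nat}) : R :=
  ln ((\max_(n <- t) n)%N)%:R / ln (radical (\prod_(n <- t) n)%N)%:R.

Definition abc_inequality (R : realType) (kappa : R) (S : set {mset nat}) :
    Prop :=
  forall eps : R, 0 < eps ->
    finite_set [set t | S t /\ kappa + eps < quality R t].

Definition abc_conjecture (R : realType) : Prop :=
  abc_inequality (1 : R) coprime_triples.

Definition solution_triples : set {mset nat} :=
  [set t | exists x y k : int,
     primitive_solution x y k /\
     t = triple `|x ^+ 3|%N `|k|%N `|y ^+ 2|%N].

Definition weak_hall_primitive (R : realType) : Prop :=
  forall delta : R, 0 < delta ->
    finite_set [set s : int * int * int | let: (x, y, k) := s in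
      [/\ primitive_solution x y k, 0 < `|k| &
          `|k|%:~R < x%:~R `^ (2^-1 - delta)]].

Definition gamma (R : realType) (kappa : R) : R := 3 / kappa - 5 / 2.

(* Main.v *)
(* Let g = gamma(kappa) - delta <= 1/2.  A solution with |k| < x^g has
   |k| <= x, hence y^2 <= 2 x^3, so that rad(x y |k|) <= x y |k| is at most
   sqrt 2 * x^(5/2 + g) = sqrt 2 * x^(3/kappa - delta), whereas the largest term
   of the triple is at least x^3.  With eps = delta / 6 the quality thus exceeds
   kappa + eps as soon as x is large.  The abc inequality then bounds the
   largest term of the triple, hence x, and a bound on x bounds y and k. *)

Require Import Defs.
From mathcomp Require Import all_boot all_order all_algebra finmap multiset.
From mathcomp Require Import all_classical all_reals all_analysis.
From mathcomp Require Import zify lra.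

Import Order.TTheory GRing.Theory Num.Theory.

Local Open Scope classical_set_scope.
Local Open Scope ring_scope.

Lemma eq_radical (m n : nat) : primes m = primes n -> radical m = radical n.
Proof. by rewrite /radical => ->. Qed.

Lemma radical_leq {n : nat} : (0 < n)%N -> (radical n <= n)%N.
Proof.
move=> n0; rewrite [leqRHS](prod_prime_decomp n0) prime_decompE big_map.
rewrite /radical big_seq [leqRHS]big_seq.
apply: leq_prod => p; rewrite mem_primes => /and3P[pp _ pn].
by rewrite -{1}(expn1 p) leq_exp2l ?prime_gt1// -pfactor_dvdn// expn1.
Qed.

Lemma radical_gt1 (n : nat) : (1 < n)%N -> (1 < radical n)%N.
Proof.
move=> n1; have pn : pdiv n \in primes n.
  by rewrite mem_primes pdiv_prime// pdiv_dvd (ltnW n1).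
rewrite /radical (big_rem _ pn)/=.
rewrite (leq_trans (prime_gt1 (pdiv_prime n1)))// leq_pmulr//.
rewrite big_seq prodn_cond_gt0// => p /mem_rem.
by rewrite mem_primes => /andP[/prime_gt0].
Qed.

Lemma radical_powers (x k y : nat) : (0 < x)%N -> (0 < k)%N -> (0 < y)%N ->
  radical (x ^ 3 * k * y ^ 2) = radical (x * k * y).
Proof.
move=> x0 k0 y0; apply/eq_radical/eq_primes => p.
by rewrite !primesM ?muln_gt0 ?expn_gt0 ?x0 ?k0 ?y0 // !orbb.
Qed.

(** A multiset enumerates its terms only up to permutation, hence the commutative [op]. *)
Lemma big_triple (T : Type) (idx : T) (op : Monoid.com_law idx)
    (F : nat -> T) (a b c : nat) :
  \big[op/idx]_(n <- triple a b c) F n = op (F a) (op (F b) (F c)).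
Proof.
rewrite (perm_big _ (perm_eq_seq_mset [:: a; b; c])) !big_cons big_nil.
by rewrite Monoid.mulm1.
Qed.

Lemma quality_triple (R : realType) (a b c : nat) :
  quality R (triple a b c) =
  ln (maxn a (maxn b c))%:R / ln (radical (a * b * c))%:R.
Proof. by rewrite /quality !big_triple /= mulnA. Qed.

Lemma solution_triples_coprime : solution_triples `<=` coprime_triples.
Proof.
move=> t [x [y [k [[[E x1 y1 k0] g] ->]]]].
have gn : coprime `|x| `|y|.
  by move: g; rewrite /gcdz => -[g]; rewrite /coprime g.
have g32 : gcdn (`|x| ^ 3) (`|y| ^ 2) = 1%N.
  by apply/eqP; rewrite -/(coprime _ _) coprimeXl// coprimeXr.
have X0 : (0 < `|x ^+ 3|)%N by rewrite abszX expn_gt0; lia.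
have Y0 : (0 < `|y ^+ 2|)%N by rewrite abszX expn_gt0; lia.
have K0 : (0 < `|k|)%N by lia.
have X3 : 0 < x ^+ 3 by rewrite exprn_gt0//; lia.
have Y2 : 0 < y ^+ 2 by rewrite exprn_gt0//; lia.
(* The sign of [k] decides which term is the sum: x^3 + |k| = y^2 or y^2 + |k| = x^3. The gcd of the
   three terms is 1 because x^3 and y^2 are already coprime. *)
have [kp|kn] := ltP 0 k.
- exists `|x ^+ 3|%N, `|k|%N, `|y ^+ 2|%N; split=> //; last by lia.
  by rewrite gcdnAC !abszX g32 gcd1n.
- exists `|y ^+ 2|%N, `|k|%N, `|x ^+ 3|%N; split=> //; last by lia.
    by apply/eq_seq_msetP/(permEl (perm_rev [:: _; _; _])).
  by rewrite gcdnAC !abszX [gcdn (_ ^ 2) _]gcdnC g32 gcd1n.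
Qed.

Lemma finite_int_itv (N : nat) : finite_set [set z : int | (`|z| <= N)%N].
Proof.
apply: (@sub_finite_set _ _ [set n%:Z - N%:Z | n in `I_(2 * N).+1]).
  by move=> z /= zN; exists (absz (z + N%:Z)); rewrite /=; lia.
exact/finite_image/finite_II.
Qed.

(** Since y <= y^2 = x^3 + k <= N^3 + N, all three coordinates lie in finite intervals. *)
Lemma finite_bounded_solutions (N : nat) :
  finite_set [set s : int * int * int | let: (x, y, k) := s in
    [/\ solution x y k, (`|k| <= `|x|)%N & (`|x| <= N)%N]].
Proof.
apply: (@sub_finite_set _ _
  ([set z : int | (`|z| <= N)%N] `*` [set z : int | (`|z| <= N ^ 3 + N)%N] `*`
   [set z : int | (`|z| <= N)%N])); last first.
  by do !apply: finite_setX => //; exact: finite_int_itv.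
move=> [[x y] k] [[E x1 y1 k0] kx xN]; split => /=; last by lia.
split => //=.
have : (`|x| ^ 3 <= N ^ 3)%N by rewrite leq_exp2r.
have : y <= y ^+ 2 by nia.
rewrite E -abszX; lia.
Qed.

(** Only a bound on the largest term is kept, so that there is no need to count the solutions that
    share a triple. *)
Lemma finite_quality_bound {R : realType} {c : R} {S : set {mset nat}%mset} :
  finite_set [set t | S t /\ c < quality R t] ->
  exists N : nat, forall t, S t -> c < quality R t ->
    (\max_(n <- t) n <= N)%N.
Proof.
move=> /finite_seqP[s Es].
pose F (t : {mset nat}%mset) := (\max_(n <- t) n)%N.
exists (\max_(t <- s) F t)%N => t St ct.
apply: (leq_bigmax_seq (F := F)) => //.
by have : [set` s] t by rewrite -Es.
Qed.

Lemma gamma_le_half {R : realType} {kappa : R} :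
  1 <= kappa -> gamma kappa <= 2^-1.
Proof.
move=> kappa1; have : 3 / kappa <= 3 by rewrite ler_pdivrMr; lra.
by rewrite /gamma; lra.
Qed.

Lemma solution_small_k {R : realType} {kappa delta : R} {x y k : int} :
  1 <= kappa -> 0 < delta -> solution x y k ->
  `|k|%:~R < (x%:~R : R) `^ (gamma kappa - delta) -> `|k| <= x.
Proof.
move=> kappa1 delta0 [_ x1 _ _] kx; rewrite -(ler_int R).
have x1R : 1 <= x%:~R :> R by rewrite -(ler_int R) in x1.
apply/ltW/(lt_le_trans kx); rewrite -[leRHS]powRr1; last by lra.
by apply: ler_powR => //; have := gamma_le_half kappa1; lra.
Qed.

(** In units of ln x, the factors x, |k| and y contribute 1, gamma - delta and 3/2; the -5/2 in
    [gamma] makes the sum 3/kappa - delta. *)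
Lemma ln_radical_le {R : realType} {kappa delta : R} {x y k : int} :
  1 <= kappa -> 0 < delta -> solution x y k ->
  `|k|%:~R < (x%:~R : R) `^ (gamma kappa - delta) ->
  ln (radical (`|x| * `|k| * `|y|))%:R <=
  (3 / kappa - delta) * ln x%:~R + ln 2 / 2 :> R.
Proof.
move=> kappa1 delta0 sol kx; have kle := solution_small_k kappa1 delta0 sol kx.
case: sol => E x1 y1 k0.
have X0 : 0 < x%:~R :> R by rewrite ltr0z; lia.
have Y0 : 0 < y%:~R :> R by rewrite ltr0z; lia.
have K0 : 0 < `|k|%:~R :> R by rewrite ltr0z; lia.
have P0 : (0 < `|x| * `|k| * `|y|)%N by rewrite !muln_gt0; lia.
have R0 := radical_leq P0.
apply: (@le_trans _ _ (ln (x%:~R * `|k|%:~R * y%:~R))).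
  rewrite ler_ln ?posrE ?mulr_gt0//; last first.
    rewrite ltr0n /radical big_seq prodn_cond_gt0// => p.
    by rewrite mem_primes => /andP[/prime_gt0].
  rewrite -!intrM -[leLHS]/((Posz (radical _))%:~R) ler_int.
  apply: (@le_trans _ _ (Posz (`|x| * `|k| * `|y|))); first by [].
  by rewrite !PoszM !abszE ger0_norm ?[X in _ * X]ger0_norm//; lia.
rewrite !lnM ?posrE ?mulr_gt0//.
have lk : ln `|k|%:~R <= (gamma kappa - delta) * ln x%:~R :> R.
  by rewrite -ln_powR ler_ln ?posrE ?powR_gt0// ltW.
have ly : 2 * ln y%:~R <= ln 2 + 3 * ln x%:~R :> R.
  rewrite 2!mulr_natl -!lnXn// -lnM ?posrE ?exprn_gt0//.
  rewrite ler_ln ?posrE ?mulr_gt0 ?exprn_gt0//.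
  rewrite -!rmorphXn/= -[X in X * _]/(2%:~R) -intrM ler_int E.
  (* With k <= x this gives y^2 = x^3 + k <= 2 x^3. *)
  have : x <= x ^+ 3 by rewrite ler_eXnr.
  lia.
rewrite /gamma in lk.
by nra.
Qed.

(** The bound on ln rad, times kappa + delta/6, stays below 3 ln x with a margin of (delta/2) ln x;
    the last hypothesis says that this margin absorbs the constant coming from sqrt 2. *)
Lemma large_solution_quality {R : realType} {kappa delta : R} {x y k : int} :
  1 <= kappa -> 0 < delta -> solution x y k ->
  `|k|%:~R < (x%:~R : R) `^ (gamma kappa - delta) ->
  (kappa + delta / 6) * (ln 2 / 2) < delta / 2 * ln x%:~R ->
  kappa + delta / 6 < quality R (triple `|x ^+ 3|%N `|k|%N `|y ^+ 2|%N).
Proof.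
move=> kappa1 delta0 sol kx large.
have lrad := ln_radical_le kappa1 delta0 sol kx.
case: sol => E x1 y1 k0.
have X0 : 0 < x%:~R :> R by rewrite ltr0z; lia.
have ln2 : 0 < ln 2 :> R by rewrite ln_gt0//; lra.
have Lpos : 0 < ln x%:~R :> R.
  have : 0 < (kappa + delta / 6) * (ln 2 / 2).
    by rewrite mulr_gt0// ?divr_gt0//; lra.
  by nra.
have x2 : 1 < x.
  rewrite lt_neqAle x1 andbT; apply/eqP => x1'.
  by rewrite -x1' ln1 ltxx in Lpos.
rewrite quality_triple !abszX radical_powers; try lia.
(* As x >= 2, the denominator of the quality is positive and can be cleared. *)
have rad1 : (1 < radical (`|x| * `|k| * `|y|))%N.
  apply: radical_gt1.
  by rewrite -mulnA (leq_trans _ (leq_pmulr _ _)) ?muln_gt0; lia.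
rewrite ltr_pdivlMr; last by rewrite ln_gt0// ltr1n.
apply: (@lt_le_trans _ _ (ln (x%:~R ^+ 3))); last first.
  rewrite ler_ln ?posrE ?exprn_gt0//; last first.
    by rewrite ltr0n leq_max expn_gt0; lia.
  rewrite -[x]gez0_abs; last by lia.
  by rewrite -pmulrn -natrX ler_nat leq_maxl.
rewrite lnXn// -[ltRHS]mulr_natl.
have kk : kappa * (3 / kappa) = 3 by rewrite mulrC divfK//; lra.
have k3 : 3 / kappa <= 3 by rewrite ler_pdivrMr; lra.
have ke : 0 < kappa + delta / 6 by lra.
apply: (le_lt_trans (ler_wpM2l (ltW ke) lrad)).
rewrite mulrDr -ltrBrDl (lt_le_trans large)//.
(* The product is 3 - kappa delta + delta/(2 kappa) - delta^2/6. For kappa >= 1 the second term is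
   at most -delta and, by the choice eps = delta/6, the third at most delta/2. *)
have : (kappa + delta / 6) * (3 / kappa - delta) <= 3 - delta / 2.
  by rewrite mulrDl mulrBr kk; nra.
by move=> /(ler_wpM2r (ltW Lpos)); lra.
Qed.

Lemma finite_small_solutions {R : realType} {kappa delta : R} :
  1 <= kappa -> 0 < delta -> abc_inequality kappa solution_triples ->
  finite_set [set s : int * int * int | let: (x, y, k) := s in
    primitive_solution x y k /\
    (`|k|%:~R < (x%:~R : R) `^ (gamma kappa - delta))].
Proof.
move=> kappa1 delta0 abc; have eps0 : 0 < delta / 6 by lra.
have [N1 maxN1] := finite_quality_bound (abc _ eps0).
(* [B] solves the size condition of [large_solution_quality] with equality, so a solution that fails
   the condition has x <= [B]. *)
pose B := expR ((kappa + delta / 6) * ln 2 / delta).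
apply: sub_finite_set (finite_bounded_solutions (maxn N1 (Num.truncn B))).
move=> [[x y] k] [prim kx]; have [sol gxy] := prim.
have kle := solution_small_k kappa1 delta0 sol kx.
have [E x1 y1 k0] := sol.
split=> //; first by lia.
rewrite leq_max.
have [large|small] :=
  ltP ((kappa + delta / 6) * (ln 2 / 2)) (delta / 2 * ln (x%:~R : R)).
  apply/orP; left.
  have q := large_solution_quality kappa1 delta0 sol kx large.
  apply: leq_trans (maxN1 _ _ q); last by exists x, y, k.
  (* [N1] bounds the largest term, which is at least x^3 >= x. *)
  rewrite big_triple abszX /= leq_max -{1}(expn1 `|x|) leq_pexp2l//; lia.
apply/orP; right.
have X0 : 0 < x%:~R :> R by rewrite ltr0z; lia.
rewrite truncn_ge_nat ?expR_ge0//.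
rewrite pmulrn gez0_abs; last by lia.
rewrite -[leLHS](@lnK R) ?posrE// ler_expR ler_pdivlMr//.
by lra.
Qed.

Theorem corollary4p1 (R : realType) :
  (forall kappa : R, 1 <= kappa -> kappa < 6 / 5 ->
     abc_inequality kappa solution_triples ->
     forall delta : R, 0 < delta -> delta < gamma kappa ->
       finite_set [set s : int * int * int | let: (x, y, k) := s in
         primitive_solution x y k /\
         (`|k|%:~R < x%:~R `^ (gamma kappa - delta))]) /\
  (abc_conjecture R -> weak_hall_primitive R).
Proof.
split=> [kappa k1 _ abc delta d0 _|abc delta d0].
  exact: finite_small_solutions.
(* Finiteness over all coprime triples restricts to those formed by solutions. *)
have abc' : abc_inequality (1 : R) solution_triples.
  move=> eps e0; apply: sub_finite_set (abc eps e0).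
  by move=> t [/solution_triples_coprime].
have := finite_small_solutions (lexx _) d0 abc'.
have -> : gamma (1 : R) = 2^-1 by rewrite /gamma; lra.
by apply: sub_finite_set => -[[x y] k] [].
Qed.
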